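(* For every graph $H$ we have $\operatorname{box}_\ell(H)\le 2(\chi_a(H)-1)$.
   Context: All graphs are finite and simple; $H^c$ denotes the complement of $H$. The acyclic chromatic number $\chi_a(H)$ is the smallest $k$ such that $H$ has a proper vertex coloring with $k$ colors in which any two color classes together induce a forest. An interval graph is an intersection graph of intervals on the real line; a co-interval graph is the complement of an interval graph; $\mathcal{C}$ is the class of all co-interval graphs. The local boxicity $\operatorname{box}_\ell(H)$ is the minimum $s$ such that there exist co-interval graphs $G_1,\ldots,G_t$ (for some $t$), each a subgraph of $H^c$, with $E(H^c)=E(G_1)\cup\cdots\cup E(G_t)$ and every vertex of $H$ lying in at most $s$ of the $G_i$. (Equivalently, in covering-number terms, $\operatorname{box}_\ell(H)=c_\ell^{\mathcal{C}}(H^c)$, the minimum $s$ for which there is an edge-surjective homomorphism $\varphi: G_1\sqcup\cdots\sqcup G_t\to H^c$ with each $G_i\in\mathcal{C}$, injective on each $G_i$, and with $|\varphi^{-1}(v)|\le s$ for all $v$.)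
   Formalization: Edgeless graphs H with at least two vertices are excluded, since there χ_a(H)=1 makes the bound 0 while H^c has an edge, so box_ℓ(H) ≥ 1; for the graph with no vertices the bound is read as 0. *)

(* Defs.v *)
From mathcomp Require Import all_boot all_order all_algebra.
From mathcomp Require Import boolp reals.

Set Implicit Arguments.
Unset Strict Implicit.
Unset Printing Implicit Defensive.

Import Order.TTheory GRing.Theory Num.Theory.

Record sgraph := SGraph {
  vertex :> finType;
  adj : rel vertex;
  adj_sym : symmetric adj;
  adj_irrefl : irreflexive adj }.

Section Complement.
Variable G : sgraph.

Definition compl_adj : rel G := fun x y => (x != y) && ~~ adj x y.

Lemma compl_adj_sym : symmetric compl_adj.
Proof. by move=> x y; rewrite /compl_adj eq_sym adj_sym. Qed.

Lemma compl_adj_irrefl : irreflexive compl_adj.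
Proof. by move=> x; rewrite /compl_adj eqxx. Qed.

Definition complement : sgraph := SGraph compl_adj_sym compl_adj_irrefl.

End Complement.

(* Not necessarily induced, not necessarily spanning. *)
Record subgraph (G : sgraph) := Subgraph {
  sub_verts : {set G};
  sub_adj : rel G;
  sub_adj_sym : symmetric sub_adj;
  sub_adj_verts : forall x y, sub_adj x y -> x \in sub_verts;
  sub_adj_sub : subrel sub_adj (@adj G) }.

Section GraphOfSubgraph.
Variables (G : sgraph) (S : subgraph G).

Definition gsub_adj : rel {x : G | x \in sub_verts S} :=
  fun x y => sub_adj S (val x) (val y).

Lemma gsub_adj_sym : symmetric gsub_adj.
Proof. by move=> x y; apply: sub_adj_sym. Qed.

Lemma gsub_adj_irrefl : irreflexive gsub_adj.
Proof.
move=> x; apply/negP => /sub_adj_sub.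
by rewrite adj_irrefl.
Qed.

Definition graph_of_subgraph : sgraph := SGraph gsub_adj_sym gsub_adj_irrefl.

End GraphOfSubgraph.
Coercion graph_of_subgraph : subgraph >-> sgraph.

Section Induced.
Variables (G : sgraph) (A : {set G}).

Definition ind_adj : rel G := fun x y => [&& x \in A, y \in A & adj x y].

Lemma ind_adj_sym : symmetric ind_adj.
Proof. by move=> x y; rewrite /ind_adj adj_sym andbCA. Qed.

Lemma ind_adj_verts x y : ind_adj x y -> x \in A.
Proof. by case/and3P. Qed.

Lemma ind_adj_sub : subrel ind_adj (@adj G).
Proof. by move=> x y /and3P[]. Qed.

Definition induced : subgraph G := Subgraph ind_adj_sym ind_adj_verts ind_adj_sub.

End Induced.

(* A duplicate-free closed walk [ucycle] is a graph cycle only from length 3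
   on: [:: x; y] is a [ucycle] whenever x and y are adjacent. *)
Definition forest (G : sgraph) : Prop :=
  forall c : seq G, (2 < size c)%N -> ~ ucycle (@adj G) c.

Definition proper_coloring (G : sgraph) (k : nat) (f : G -> 'I_k) : Prop :=
  forall x y : G, adj x y -> f x != f y.

Definition acyclic_coloring (G : sgraph) (k : nat) (f : G -> 'I_k) : Prop :=
  proper_coloring f /\
  forall i j : 'I_k, i != j -> forest (induced [set x : G | (f x == i) || (f x == j)]).

Definition acyclically_colorable (G : sgraph) (k : nat) : Prop :=
  exists f : G -> 'I_k, acyclic_coloring f.

Lemma acyclically_colorable_card (G : sgraph) : acyclically_colorable G #|G|.
Proof.
exists (@enum_rank G); split.
  move=> x y xy; apply: contraTneq xy => /enum_rank_inj ->.
  by rewrite adj_irrefl.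
move=> i j _ c c_gt2 /andP[_ /card_uniqP c_uniq].
suff : (#|vertex (induced [set x : G | (enum_rank x == i) || (enum_rank x == j)])| <= 2)%N.
  by move=> le2; move: c_gt2; rewrite -c_uniq ltnNge (leq_trans (max_card _) le2).
rewrite card_sig; apply: (@leq_trans #|[set enum_val i; enum_val j]|); last first.
  by rewrite cards2 ltnS leq_b1.
apply/subset_leq_card/subsetP => x; rewrite !inE.
by case/orP=> /eqP <-; rewrite enum_rankK eqxx ?orbT.
Qed.

Definition least (P : nat -> Prop) (exP : exists n, P n) : nat :=
  ex_minn (P := fun n => `[< P n >])
    (let: ex_intro n Pn := exP in ex_intro _ n (asboolT Pn)).

Lemma leastP (P : nat -> Prop) (exP : exists n, P n) :
  P (least exP) /\ forall n, P n -> (least exP <= n)%N.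
Proof.
rewrite /least; case: ex_minnP => m /asboolP Pm min_m.
by split=> // n Pn; apply/min_m/asboolP.
Qed.

Definition acyclic_chromatic_number (G : sgraph) : nat :=
  least (ex_intro _ _ (acyclically_colorable_card G)).

(* The intervals are arbitrary nonempty ones: open, closed or half-open,
   bounded or not. *)
Definition interval_graph (R : realType) (G : sgraph) : Prop :=
  exists I : G -> interval R,
    (forall v : G, exists x : R, x \in I v) /\
    forall u v : G, u != v -> (adj u v <-> exists x : R, x \in I u /\ x \in I v).

Definition cointerval_graph (R : realType) (G : sgraph) : Prop :=
  interval_graph R (complement G).

Definition local_cointerval_cover (R : realType) (G : sgraph) (s : nat) : Prop :=
  exists (t : nat) (F : 'I_t -> subgraph G),
    [/\ forall i, cointerval_graph R (F i),
        forall x y : G, adj x y <-> exists i, sub_adj (F i) x y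
      & forall v : G, (#|[set i | v \in sub_verts (F i)]| <= s)%N].

Lemma local_cointerval_cover_ex (R : realType) (G : sgraph) :
  exists s, local_cointerval_cover R G s.
Proof.
pose P i : G * G := @enum_val (G * G)%type predT i.
pose A i : {set G} := if adj (P i).1 (P i).2 then [set (P i).1; (P i).2] else set0.
exists #|{: G * G}|, #|{: G * G}|, (fun i => induced (A i)); split.
- move=> i.
  pose I (v : complement (induced (A i))) : interval R :=
    `[(enum_rank (v : {x | x \in A i}))%:R, (enum_rank (v : {x | x \in A i}))%:R]%R.
  have memI (v : complement (induced (A i))) (x : R) :
      (x \in I v) = (x == (enum_rank (v : {x | x \in A i}))%:R%R).
    by rewrite itv_boundlr /= !bnd_simp eq_sym eq_le.
  exists I; split.
    by move=> v; exists (enum_rank (v : {x | x \in A i}))%:R%R; rewrite memI.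
  move=> u v uv; split.
    case/andP=> _ /negP[]; rewrite /= /gsub_adj /= /ind_adj.
    case: u v uv => [u uA] [v vA] uv; rewrite -[_ == _]/(u == v) in uv.
    rewrite /= uA vA /=; move: uA vA uv; rewrite /A.
    case: ifP => [a|_]; last by rewrite inE.
    rewrite !inE => /orP[]/eqP-> /orP[]/eqP->; rewrite ?eqxx // => _.
    by rewrite adj_sym.
  case=> x []; rewrite !memI => /eqP-> /eqP.
  move/eqP; rewrite eqr_nat => /eqP/val_inj/enum_rank_inj E.
  by rewrite E eqxx in uv.
- move=> x y; split=> [xy|[i]]; last exact: ind_adj_sub.
  exists (enum_rank (x, y)).
  by rewrite /= /ind_adj /A /P enum_rankK /= xy !inE !eqxx orbT.
- by move=> v; rewrite -[leqRHS]card_ord max_card.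
Qed.

Definition local_boxicity (R : realType) (H : sgraph) : nat :=
  least (local_cointerval_cover_ex R (complement H)).

(* The bound 2 * (chi_a - 1) fails for edgeless graphs on at least two
   vertices: chi_a is then 1, while the complement has an edge, so that some
   vertex lies in at least one of the covering graphs. *)
Lemma edgeless_counterexample (R : realType) (H : sgraph) :
  (1 < #|H|)%N -> (forall x y : H, ~~ adj x y) ->
  acyclic_chromatic_number H = 1%N /\ (0 < local_boxicity R H)%N.
Proof.
move=> H_gt1 noE; have [x [y [_ _ xy]]] := card_gt1P H_gt1; split.
  have [[f _] kmin] := leastP (ex_intro _ _ (acyclically_colorable_card H)).
  rewrite -/(acyclic_chromatic_number H) in f kmin *.
  apply/eqP; rewrite eqn_leq kmin ?(leq_trans _ (ltn_ord (f x))) //.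
  exists (fun _ => ord0); split=> [u v|i j]; first by rewrite (negPf (noE u v)).
  by rewrite (ord1 i) (ord1 j).
have [[t [F [_ covF leF]]] _] := leastP (local_cointerval_cover_ex R (complement H)).
have /covF[i /sub_adj_verts xi] : adj (x : complement H) (y : complement H).
  by rewrite /= /compl_adj xy noE.
by rewrite (leq_trans _ (leF x)) // card_gt0; apply/set0Pn; exists i; rewrite inE.
Qed.

(* Main.v *)
Require Import Defs.
From mathcomp Require Import all_boot all_order all_algebra.
From mathcomp Require Import boolp reals.
From mathcomp Require Import zify.

Set Implicit Arguments.
Unset Strict Implicit.
Unset Printing Implicit Defensive.

Import Order.TTheory GRing.Theory Num.Theory.

(** A forest is the intersection of two interval graphs: root every tree, and
represent a vertex on the one hand by the range of the depth-first numbers of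
its descendants, on the other hand by [depth, depth + 1].  Intervals of the
first kind meet exactly for an ancestor and a descendant, and those of the
second kind then only let parent and child meet.  Hence the complement of a
forest is the union of two co-interval graphs.  Given an acyclic coloring with
k >= 2 colors, apply this to the forest induced by each pair of color classes:
every non-edge of H lies in one of these forests, and every vertex lies in
k - 1 of them. *)

(** * Forests as intersections of two interval graphs *)

Lemma path_cat_cycle (T : eqType) (e : rel T) (x y : T) (s1 s2 : seq T) :
  path e x (s1 ++ y :: s2) -> e y x -> uniq (x :: s1 ++ y :: s2) ->
  ucycle e (x :: rcons s1 y).
Proof.
rewrite -cat_rcons cat_path => /andP[p1 _] yx u; apply/andP; split.
  by rewrite /= rcons_path p1 last_rcons.
by move: u; rewrite -cat_cons cat_uniq => /and3P[].
Qed.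

Section ForestRepresentation.
Variables (T : finType) (e : rel T).
Hypotheses (e_sym : symmetric e) (e_irr : irreflexive e).

(** Phrased inside the fixed type [T], so that an induction can delete vertices from [A] without
    changing the ambient graph. *)
Definition acyclic_in (A : {set T}) : Prop :=
  forall c : seq T, {subset c <= A} -> 2 < size c -> ~ ucycle e c.

Lemma acyclic_inS (A B : {set T}) :
  B \subset A -> acyclic_in A -> acyclic_in B.
Proof. by move=> /subsetP BA acA c cB; apply: acA => x /cB /BA. Qed.

(** Otherwise a walk in [A] can always be continued without turning back. It never meets itself,
    since that would close a cycle, so it becomes a path with more than [#|T|] vertices. *)
Lemma acyclic_in_leaf (A : {set T}) : acyclic_in A -> A != set0 ->
  exists2 v, v \in A &
    forall x y, x \in A -> y \in A -> e v x -> e v y -> x = y.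
Proof.
move=> acA /set0Pn[v0 v0A]; apply: contrapT => noleaf.
have step v w : v \in A -> exists2 y, y \in A & e v y && (y != w).
  move=> vA; apply: contrapT => now; apply: noleaf; exists v => // x y xA yA vx vy.
  have eqw z : z \in A -> e v z -> z = w.
    move=> zA vz; apply/eqP; apply: contrapT => /negP zw.
    by apply: now; exists z => //; rewrite vz.
  by rewrite (eqw x) // (eqw y).
have long n : exists x s,
    [/\ path e x s, uniq (x :: s), {subset x :: s <= A} & size s = n].
  elim: n => [|n [x [s [p u sA sz]]]].
    by exists v0, [::]; split=> // x; rewrite inE => /eqP ->.
  (* The path grows at its front, so [head x s] is the vertex visited just before [x]. For empty [s]
     the default [x] excludes nothing, as [e] is irreflexive. *)
  have [y yA /andP[xy yw]] := step x (head x s) (sA _ (mem_head _ _)).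
  exists y, (x :: s); split=> /=; last by rewrite sz.
  - by rewrite e_sym xy.
  - move: (u) => /= ->; rewrite andbT inE negb_or; apply/andP; split.
      by apply: contraTneq xy => ->; rewrite e_irr.
    apply/negP => ys; case/splitPr: ys p u sA sz yw => s1 s2 p u sA _ yw.
    have yx : e y x by rewrite e_sym.
    apply: (acA (x :: rcons s1 y)); last exact: path_cat_cycle p yx u.
      move=> z zc; apply: sA; move: zc.
      by rewrite -cat_rcons -cat_cons [in X in _ -> X]mem_cat => ->.
    (* The cycle has length at least 3: [s1] is nonempty because [y] differs from the head of
       [s]. *)
    by case: s1 yw {p u sA} => [|z s1] /=; rewrite ?eqxx // size_rcons.
  - by move=> z; rewrite inE => /orP[/eqP->|/sA].
have [x [s [_ u _ sz]]] := long #|T|.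
by have := max_card (mem (x :: s)); rewrite (card_uniqP u) /= sz ltnn.
Qed.

(* [a x] and [b x] bound the depth-first numbers of the descendants of [x],
   and [d x] is its depth. *)
Lemma acyclic_in_box (A : {set T}) : acyclic_in A ->
  exists a b d : T -> nat,
    [/\ {in A, forall x, a x <= b x},
        {in A &, injective a},
        {in A &, forall x y, a x < a y <= b x -> d x < d y}
      & {in A &, forall x y, x != y ->
          e x y = [&& a x <= b y, a y <= b x, d x <= (d y).+1 & d y <= (d x).+1]}].
Proof.
move: {2}#|A| (erefl #|A|) => n; elim: n A => [|n IHn] A cardA acA.
  have ->: A = set0 by apply: cards0_eq.
  by do 3!exists (fun=> 0); split=> x; rewrite inE.
have A0 : A != set0 by rewrite -card_gt0 cardA.
have [v vA leaf] := acyclic_in_leaf acA A0.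
have [|a [b [d [ab inja mono rep]]]] := IHn (A :\ v) _ (acyclic_inS (subsetDl _ _) acA).
  by move: cardA; rewrite (cardsD1 v) vA => -[].
have inB x : x \in A -> x != v -> x \in A :\ v by rewrite !inE => -> ->.
have [[u uA vu]|iso] := pselect (exists2 u, u \in A & e v u).
  have uv : u != v by apply: contraTneq vu => ->; rewrite e_irr.
  have uB := inB _ uA uv.
  have evx x : x \in A -> e v x = (x == u).
    move=> xA; apply/idP/eqP => [vx|->//]; exact: leaf.
  (* Such an [x] is a proper ancestor of [u], hence at least two levels above [v], which will be a
     child of [u]. *)
  have far x : x \in A -> x != v -> x != u -> a x <= a u <= b x -> d x < d u.
    move=> xA xv xu /andP[au ub]; apply: mono => //; first exact: inB.
    rewrite ub andbT ltn_neqAle au andbT.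
    by apply: contra_neq xu; apply: inja => //; apply: inB.
  have abu := ab _ uB.
  (* Doubling frees the odd numbers: [v] gets a single point just after the start of [u]. The
     stretched interval of another [x] contains this point exactly when [a x <= a u <= b x]. *)
  exists (fun x => if x == v then (a u).*2.+1 else (a x).*2).
  exists (fun x => if x == v then (a u).*2.+1 else (b x).*2.+1).
  exists (fun x => if x == v then (d u).+1 else d x); split.
  - by move=> x xA; case: eqVneq => // xv; have := ab _ (inB _ xA xv); lia.
  - move=> x y xA yA; case: (eqVneq x v) => [->|xv]; case: (eqVneq y v) => [->|yv] //; try lia.
    by move=> /double_inj; apply: inja; apply: inB.
  - move=> x y xA yA; case: (eqVneq x v) => [_|xv]; case: (eqVneq y v) => [_|yv]; try lia.
      case: (eqVneq x u) => [->|xu]; first lia.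
      by have := far x xA xv xu; lia.
    by have := mono x y (inB _ xA xv) (inB _ yA yv); lia.
  - move=> x y xA yA; case: (eqVneq x v) => [->|xv]; case: (eqVneq y v) => [->|yv]; rewrite ?eqxx // => xy.
    + rewrite evx //; case: (eqVneq y u) => [->|yu]; first by symmetry; lia.
      by have := far y yA yv yu; lia.
    + rewrite e_sym evx //; case: (eqVneq x u) => [->|xu]; first by symmetry; lia.
      by have := far x xA xv xu; lia.
    + by rewrite (rep x y (inB _ xA xv) (inB _ yA yv) xy); lia.
have evx x : x \in A -> e v x = false.
  by move=> xA; apply/negP => vx; apply: iso; exists x.
(* The isolated [v] forms a tree of its own, placed at 0 in front of all the others, which move up
   by one. *)
exists (fun x => if x == v then 0 else (a x).+1).
exists (fun x => if x == v then 0 else (b x).+1).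
exists (fun x => if x == v then 0 else d x); split.
- by move=> x xA; case: eqVneq => // xv; have := ab _ (inB _ xA xv); lia.
- move=> x y xA yA; case: (eqVneq x v) => [->|xv]; case: (eqVneq y v) => [->|yv] //.
  by move=> [] /inja; apply; apply: inB.
- move=> x y xA yA; case: (eqVneq x v) => [_|xv]; case: (eqVneq y v) => [_|yv]; try lia.
  by have := mono x y (inB _ xA xv) (inB _ yA yv); lia.
- move=> x y xA yA; case: (eqVneq x v) => [->|xv]; case: (eqVneq y v) => [->|yv]; rewrite ?eqxx // => xy.
  + by rewrite evx.
  + by rewrite e_sym evx //; lia.
  + by rewrite (rep x y (inB _ xA xv) (inB _ yA yv) xy); lia.
Qed.

End ForestRepresentation.

Lemma forest_induced_acyclic_in (G : sgraph) (A : {set G}) :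
  forest (induced A) -> acyclic_in (@adj G) A.
Proof.
move=> fA c cA c_gt2 /andP[cyc u].
have [c' cE] : exists c' : seq {x : G | x \in A}, c = map val c'.
  elim: c cA {c_gt2 cyc u} => [|x c IHc] cA; first by exists [::].
  have [|c' ->] := IHc; first by move=> y yc; apply: cA; rewrite inE yc orbT.
  by exists (Sub x (cA _ (mem_head _ _)) :: c').
subst c; apply: (fA c'); first by rewrite size_map in c_gt2.
rewrite (map_inj_uniq val_inj) in u; apply/andP; split=> //.
move: cyc; rewrite cycle_map; apply: sub_cycle => x y /= xy.
by rewrite /gsub_adj /= /ind_adj (valP x) (valP y).
Qed.

(** * Co-interval graphs from disjoint intervals *)

Section DisjointIntervals.
Variables (G : sgraph) (A : {set G}) (l r : G -> nat).

Definition disj_adj : rel G := fun x y =>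
  [&& x \in A, y \in A, adj x y & (r x < l y) || (r y < l x)].

Lemma disj_adj_sym : symmetric disj_adj.
Proof. by move=> x y; rewrite /disj_adj adj_sym orbC andbCA. Qed.

Lemma disj_adj_verts x y : disj_adj x y -> x \in A.
Proof. by case/and4P. Qed.

Lemma disj_adj_sub : subrel disj_adj (@adj G).
Proof. by move=> x y /and4P[]. Qed.

Definition disj_subgraph : subgraph G :=
  Subgraph disj_adj_sym disj_adj_verts disj_adj_sub.

(** By the second hypothesis disjoint intervals force adjacency in [G], so adjacency in the
    complement of [disj_subgraph] means exactly that the closed intervals from [l] to [r] meet. *)
Lemma cointerval_disj_subgraph (R : realType) :
  {in A, forall x, l x <= r x} ->
  {in A &, forall x y, r x < l y -> adj x y} ->
  cointerval_graph R disj_subgraph.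
Proof.
move=> lr disj.
pose I (v : complement disj_subgraph) : interval R :=
  `[(l (val v))%:R, (r (val v))%:R]%R.
exists I; split=> [v|u v uv].
  by exists (l (val v))%:R%R; rewrite in_itv /= lexx ler_nat (lr _ (valP v)).
have [uA vA] := (valP u, valP v).
have -> : adj u v = (l (val v) <= r (val u)) && (l (val u) <= r (val v)).
  rewrite /= /compl_adj uv /= /gsub_adj /= /disj_adj uA vA /=.
  rewrite andb_idl; first by rewrite !ltnNge -negb_and negbK.
  by case/orP; [apply: disj|rewrite adj_sym; apply: disj].
split=> [/andP[vu uv']|[x []]].
  exists (maxn (l (val u)) (l (val v)))%:R%R.
  rewrite !in_itv /= !ler_nat !geq_max !leq_max !leqnn ?orbT /=.
  by rewrite vu uv' (lr _ uA) (lr _ vA).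
rewrite !in_itv /= => /andP[ux xu] /andP[vx xv].
by rewrite -!(ler_nat R) (le_trans vx xu) (le_trans ux xv).
Qed.

End DisjointIntervals.

(** One graph for each representation: [true] for descendant ranges, [false] for depths.
    Disjointness in either one rules out an edge of [H], and every non-edge is disjoint in at least
    one. *)
Lemma complement_forest_cover (R : realType) (H : sgraph) (A : {set H}) :
  acyclic_in (@adj H) A ->
  exists F : bool -> subgraph (complement H),
    [/\ forall i, sub_verts (F i) = A,
        forall i, cointerval_graph R (F i)
      & {in A &, forall x y, @compl_adj H x y -> exists i, sub_adj (F i) x y}].
Proof.
move=> /(acyclic_in_box (@adj_sym H) (@adj_irrefl H))[a [b [d [ab inja mono rep]]]].
exists (fun i => if i then @disj_subgraph (complement H) A a b
                 else @disj_subgraph (complement H) A d (S \o d)); split.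
- by case.
- case; apply: cointerval_disj_subgraph => // x y xA yA /=.
    case: (eqVneq x y) => [->|xy]; first by have := ab _ yA; lia.
    by rewrite /compl_adj xy (rep x y) //; lia.
  case: (eqVneq x y) => [->|xy]; first by lia.
  by rewrite /compl_adj xy (rep x y) //; lia.
- move=> x y xA yA cxy; case/andP: (cxy) => xy; rewrite (rep x y) // => nbox.
  case: (boolP ((b x < a y) || (b y < a x))) => [dis|meet]; [exists true|exists false];
    rewrite /= /disj_adj xA yA /= cxy //=; lia.
Qed.

(** * Covering the complement by pairs of color classes *)

Lemma local_cointerval_cover_fin (R : realType) (G : sgraph) (I : finType)
    (F : I -> subgraph G) (s : nat) :
  (forall i, cointerval_graph R (F i)) ->
  (forall x y : G, adj x y -> exists i, sub_adj (F i) x y) ->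
  (forall v : G, #|[set i | v \in sub_verts (F i)]| <= s) ->
  local_cointerval_cover R G s.
Proof.
move=> coF covF leF; exists #|I|, (fun i => F (enum_val i)); split=> // [x y|v].
  split=> [/covF[i xy]|[i]]; last exact: sub_adj_sub.
  by exists (enum_rank i); rewrite enum_rankK.
apply: leq_trans (leF v); rewrite -(card_imset _ enum_val_inj).
by apply/subset_leq_card/subsetP => _ /imsetP[i vi ->]; rewrite !inE in vi *.
Qed.

(** A pair through [c] is determined by its other member, one of the [k - 1] colors different from
    [c]. *)
Lemma card_pairs_through (k : nat) (c : 'I_k) :
  #|[set p : 'I_k * 'I_k | (p.1 < p.2) && ((c == p.1) || (c == p.2))]| <= k - 1.
Proof.
pose other (p : 'I_k * 'I_k) := if c == p.1 then p.2 else p.1.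
rewrite -(card_in_imset (f := other)).
  rewrite subn1 -[k in k.-1]card_ord -(cardsC1 c).
  apply/subset_leq_card/subsetP => _ /imsetP[[i j] + ->].
  rewrite !inE /other /=; case: (eqVneq c i) => [<-|ci] /andP[lt _].
    by rewrite neq_ltn lt orbT.
  by rewrite eq_sym.
move=> [i j] [i' j']; rewrite !inE /other /=.
case: (eqVneq c i) => [<-|ci]; case: (eqVneq c i') => [<-|ci'] /=.
- by move=> _ _ ->.
(* With [c] first in one pair and second in the other, a common other member would lie both above
   and below [c]. *)
- by move=> /andP[lt _] /andP[lt' /eqP cj'] ij; rewrite -cj' -ij in lt'; lia.
- by move=> /andP[lt /eqP cj] /andP[lt' _] ij; rewrite -cj ij in lt; lia.
- by move=> /andP[_ /eqP <-] /andP[_ /eqP <-] ->.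
Qed.

Lemma acyclic_coloring_local_cover (R : realType) (H : sgraph) (k : nat)
    (f : H -> 'I_k) :
  ((1 < #|vertex H|)%N -> exists x y : vertex H, adj x y) ->
  acyclic_coloring f ->
  local_cointerval_cover R (complement H) (2 * (k - 1)).
Proof.
move=> hH [propf forf].
(* Pairs that are not increasing get the empty set, so each unordered pair of colors counts once. *)
pose A (p : 'I_k * 'I_k) : {set H} :=
  [set x | (p.1 < p.2) && ((f x == p.1) || (f x == p.2))].
have acA p : acyclic_in (@adj H) (A p).
  case: (boolP (p.1 < p.2)) => [lt|nlt]; last first.
    by case=> [|x c] cA //; have := cA _ (mem_head _ _); rewrite inE (negPf nlt).
  have -> : A p = [set x | (f x == p.1) || (f x == p.2)].
    by apply/setP => x; rewrite !inE lt.
  by apply/forest_induced_acyclic_in/forf; rewrite neq_ltn lt.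
have [F FP] := choice (fun p => complement_forest_cover R (acA p)).
pose F' (q : ('I_k * 'I_k) * bool) := F q.1 q.2.
apply: (@local_cointerval_cover_fin R _ _ F').
- by move=> [p i]; case: (FP p) => _ coF _; apply: coF.
- move=> x y cxy; case/andP: (cxy) => xy _.
  (* If [x] and [y] share a color, any second color will do. One exists because [hH] gives an edge,
     whose ends are colored differently. *)
  have [j jx yj] : exists2 j, j != f x & (f y == f x) || (f y == j).
    case: (eqVneq (f y) (f x)) => [_|yx]; last by exists (f y) => //=; rewrite eqxx.
    have [|u [v /propf uv]] := hH; first by apply/card_gt1P; exists x, y.
    case: (eqVneq (f u) (f x)) => [ux|ux]; last by exists (f u).
    by exists (f v) => //; rewrite -ux eq_sym.
  have [p [xp yp]] : exists p, x \in A p /\ y \in A p.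
    move: jx; rewrite neq_ltn => /orP[lt|lt]; [exists (j, f x)|exists (f x, j)];
      by rewrite !inE /= lt eqxx ?orbT //= orbC.
  by case: (FP p) => _ _ /(_ _ _ xp yp cxy)[i xyi]; exists (p, i).
- move=> v.
  (* Both graphs of a pair have vertex set [A p], whence the factor 2. *)
  have -> : [set q | v \in sub_verts (F' q)] = setX [set p | v \in A p] setT.
    by apply/setP => [[p i]]; rewrite !inE /F' /=; case: (FP p) => -> _ _; rewrite inE andbT.
  rewrite cardsX cardsT card_bool mulnC leq_mul2l /=.
  apply: leq_trans (card_pairs_through (f v)).
  by apply/subset_leq_card/subsetP => p; rewrite !inE.
Qed.

Theorem theorem6 (R : realType) (H : sgraph)
    (hH : (1 < #|vertex H|)%N -> exists x y : vertex H, adj x y) :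
  (local_boxicity R H <= 2 * (acyclic_chromatic_number H - 1))%N.
Proof.
have [[f fP] _] := leastP (ex_intro _ _ (acyclically_colorable_card H)).
have [_ minb] := leastP (local_cointerval_cover_ex R (complement H)).
exact/minb/(acyclic_coloring_local_cover R hH fP).
Qed.
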